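(* Let $n\in\mathbb{N}=\{1,2,3,\dots\}$. The following data $\mathcal{B}=\mathcal{B}_n$ form a (strict) $2$-category: - there is one object $\mathtt{i}$; - the $1$-morphisms are the elements of the symmetric group $S_n$, composed as in $S_n$, and the identity $1$-morphism is $\mathrm{id}_{\mathbf{n}}\in S_n$; - for $\pi,\sigma\in S_n$, $\mathrm{Hom}_{\mathcal{B}}(\pi,\sigma)$ is the set of all $\alpha\in\mathbf{PP}_n$ such that $\pi\le\alpha$ and $\sigma\le\alpha$; - the vertical composition of $\alpha\in\mathrm{Hom}_{\mathcal{B}}(\pi,\sigma)$ and $\beta\in\mathrm{Hom}_{\mathcal{B}}(\sigma,\tau)$ is $\beta\circ_1\alpha:=\beta\vee\alpha$; - the identity $2$-morphism in $\mathrm{Hom}_{\mathcal{B}}(\pi,\pi)$ is $\pi$; - the horizontal composition of $\alpha\in\mathrm{Hom}_{\mathcal{B}}(\pi,\sigma)$ and $\beta\in\mathrm{Hom}_{\mathcal{B}}(\tau,\rho)$ is $\beta\circ_0\alpha:=\beta\alpha$, the product in the partition monoid $\mathbf{P}_n$.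
   Context: $\mathbf{n}=\{1,\dots,n\}$ and $S_n$ is the group of bijections of $\mathbf{n}$. $\mathbf{P}_n$ is the partition monoid: its elements are the set partitions of $\overline{\mathbf{n}}=\{1,\dots,n,1',\dots,n'\}$ into nonempty parts. The product $\rho\pi$ is obtained as follows: regard $\rho$ as a partition of $\{1',\dots,n',1'',\dots,n''\}$ via $x\mapsto x'$, $x'\mapsto x''$; let $\tau$ be the finest partition of $\{1,\dots,n,1',\dots,n',1'',\dots,n''\}$ such that each part of $\rho$ and of $\pi$ is contained in a part of $\tau$; restrict $\tau$ to $\{1,\dots,n,1'',\dots,n''\}$ (intersecting parts with this set and discarding empty intersections), and rename $x''$ to $x'$. $\mathbf{P}_n$ is ordered by refinement: $\rho\le\tau$ iff each part of $\rho$ is contained in a part of $\tau$; $\vee$ denotes the join in this lattice. $S_n$ is a submonoid of $\mathbf{P}_n$ via $\sigma\mapsto\{\{x,\sigma(x)'\}:x\in\mathbf{n}\}$. $\mathbf{PP}_n$ is the submonoid of $\mathbf{P}_n$ of partitions all of whose parts are propagating, i.e. meet both $\{1,\dots,n\}$ and $\{1',\dots,n'\}$. A (strict) $2$-category is a category enriched over the category of small categories. *)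

(* Defs.v *)
From HB Require Import structures.
From mathcomp Require Import all_boot all_fingroup.

Set Implicit Arguments.
Unset Strict Implicit.
Unset Printing Implicit Defensive.

Record setpart (T : finType) := SetPart {
  parts :> {set {set T}};
  partsP : partition parts [set: T]
}.

HB.instance Definition _ (T : finType) := [isSub for @parts T].
HB.instance Definition _ (T : finType) := [Finite of setpart T by <:].

Section SetPartitions.
Variable T : finType.
Implicit Types (F : {set {set T}}) (rho tau : setpart T).

(** [F] is an arbitrary family of subsets, not necessarily a partition. *)
Definition refines F tau : bool :=
  [forall B in F, [exists C in (tau : {set {set T}}), B \subset C]].

Definition linked F : rel T := fun x y => [exists B in F, (x \in B) && (y \in B)].

Lemma linked_equiv F :
  {in [set: T] & &, equivalence_rel (connect (linked F))}.
Proof.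
have sC : connect_sym (linked F).
  apply: sym_connect_sym => x y.
  by apply: eq_existsb => B; rewrite (andbC (x \in B)).
move=> x y z _ _ _; split=> [|xy]; first exact: connect0.
exact: same_connect.
Qed.

(** The finest partition of [T] such that each member of [F] is contained in
    a part; its characteristic property is [refines_finest], [finest_le]. *)
Definition finest F : setpart T :=
  SetPart (equivalence_partitionP (@linked_equiv F)).

Lemma refines_finest F : set0 \notin F -> refines F (finest F).
Proof.
move=> F0; apply/'forall_implyP => B FB.
have /set0Pn[x Bx] : B != set0 by apply: contraNneq F0 => <-.
apply/'exists_andP; exists [set y in [set: T] | connect (linked F) x y].
split; first by apply/imsetP; exists x; rewrite ?inE.
apply/subsetP=> y By; rewrite !inE /=; apply: connect1.
by apply/'exists_andP; exists B; rewrite FB Bx By.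
Qed.

Lemma finest_le F tau : refines F tau -> refines (finest F) tau.
Proof.
move=> /'forall_implyP Ftau; apply/'forall_implyP => _ /imsetP[x _ ->].
have /and3P[/eqP covT tI _] := partsP tau.
have inT y : y \in cover tau by rewrite covT inE.
apply/'exists_andP; exists (pblock tau x); split; first by rewrite pblock_mem.
apply/subsetP=> y; rewrite inE /= inE /= => xy.
suff : pblock tau x = pblock tau y by move=> ->; rewrite mem_pblock.
case/connectP: xy => p; elim: p x => [x _ -> //|z p IHp x /= /andP[xz zp] ey].
rewrite -(IHp _ zp ey); case/'exists_andP: xz => B [FB /andP[Bx Bz]].
have /'exists_andP[C [tC /subsetP sBC]] := Ftau B FB.
by rewrite (def_pblock tI tC (sBC _ Bx)) (def_pblock tI tC (sBC _ Bz)).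
Qed.

Definition joinp rho tau : setpart T := finest (rho :|: tau).

Lemma join_lub rho tau upsilon :
  refines (joinp rho tau) upsilon = refines rho upsilon && refines tau upsilon.
Proof.
have n0 : set0 \notin rho :|: tau.
  have /and3P[_ _ r0] := partsP rho; have /and3P[_ _ t0] := partsP tau.
  by rewrite inE negb_or r0.
apply/idP/andP => [le|[/'forall_implyP ru /'forall_implyP tu]]; last first.
  apply: finest_le; apply/'forall_implyP => B; rewrite inE => /orP[]; [exact: ru|exact: tu].
have sub B : B \in rho :|: tau -> [exists C in (upsilon : {set {set T}}), B \subset C].
  move=> /(forall_inP (refines_finest n0)) /'exists_andP[C [jC BC]].
  have /'exists_andP[D [uD CD]] := forall_inP le C jC.
  by apply/'exists_andP; exists D; rewrite uD (subset_trans BC).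
by split; apply/forall_inP => B BB; apply: sub; rewrite inE BB ?orbT.
Qed.

End SetPartitions.

Section Restriction.
Variables (S T : finType) (f : S -> T) (tau : setpart T).

Lemma restrict_partition :
  partition ([set f @^-1: (B : {set T}) | B in (tau : {set {set T}})] :\ set0) [set: S].
Proof.
have /and3P[/eqP covT tI _] := partsP tau.
apply/and3P; split; last by rewrite !inE eqxx.
- apply/eqP/setP=> x; rewrite inE; apply/bigcupP.
  have fx : f x \in cover tau by rewrite covT inE.
  have xB : x \in f @^-1: pblock tau (f x) by rewrite inE mem_pblock.
  exists (f @^-1: pblock tau (f x)) => //; rewrite !inE; apply/andP; split.
    by apply/set0Pn; exists x.
  by apply: imset_f; rewrite pblock_mem.
- apply/trivIsetP => _ _ /setD1P[_ /imsetP[B tB ->]] /setD1P[_ /imsetP[C tC ->]].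
  move=> neq; have neBC : B != C by apply: contraNneq neq => ->.
  rewrite -setI_eq0 -preimsetI.
  by have /trivIsetP/(_ B C tB tC neBC) := tI; rewrite -setI_eq0 => /eqP->; rewrite preimset0.
Qed.

Definition restrict : setpart S := SetPart restrict_partition.

End Restriction.

(** [inl x] is the point x and [inr x] is the point x'. *)
Notation dbl n := ('I_n + 'I_n)%type.

(** [inl (inl x)], [inl (inr x)] and [inr x] are x, x' and x''. *)
Notation tpl n := ('I_n + 'I_n + 'I_n)%type.

Notation parmon n := (setpart (dbl n)).

Section PartitionMonoid.
Variable n : nat.
Implicit Types (rho pi alpha : parmon n) (s : 'S_n).

(** x |-> x, x' |-> x' *)
Definition lower (u : dbl n) : tpl n := inl u.

(** x |-> x', x' |-> x'' *)
Definition upper (u : dbl n) : tpl n :=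
  match u with inl x => inl (inr x) | inr x => inr x end.

(** x |-> x, x' |-> x'' *)
Definition outer (u : dbl n) : tpl n :=
  match u with inl x => inl (inl x) | inr x => inr x end.

Definition pmul rho pi : parmon n :=
  restrict outer (finest ([set upper @: (B : {set dbl n}) | B in (rho : {set {set dbl n}})] :|:
                          [set lower @: (B : {set dbl n}) | B in (pi : {set {set dbl n}})])).

Lemma graph_partition s :
  partition [set [set inl x; inr (s x)] | x : 'I_n] [set: dbl n].
Proof.
apply/and3P; split.
- apply/eqP/setP=> -[] x; rewrite inE; apply/bigcupP.
    exists [set inl x; inr (s x)]; [exact: imset_f | by rewrite in_set2 eqxx].
  exists [set inl (s^-1%g x); inr (s (s^-1%g x))]; first exact: imset_f.
  by rewrite permKV in_set2 eqxx orbT.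
- apply/trivIsetP => _ _ /imsetP[x _ ->] /imsetP[y _ ->] neq.
  have nxy : x != y by apply: contraNneq neq => ->.
  rewrite -setI_eq0; apply/eqP/setP=> -[] z; rewrite in_setI !in_set2 in_set0.
    apply/negP=> /andP[/orP[] // /eqP[zx] /orP[] // /eqP[zy]].
    by rewrite -zx -zy eqxx in nxy.
  apply/negP=> /andP[/orP[] // /eqP[->] /orP[] // /eqP[/perm_inj xy]].
  by rewrite xy eqxx in nxy.
- by apply/imsetP => -[x _ /setP/(_ (inl x))]; rewrite in_set0 in_set2 eqxx.
Qed.

Definition graph s : parmon n := SetPart (graph_partition s).

Definition propagating (B : {set dbl n}) : bool :=
  [exists x, inl x \in B] && [exists x, inr x \in B].

Definition PP : {set parmon n} :=
  [set alpha : parmon n | [forall B in (alpha : {set {set dbl n}}), propagating B]].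

End PartitionMonoid.

Record cat_data := CatData {
  ob : Type;
  hom : ob -> ob -> Type;
  idm : forall x, hom x x;
  compm : forall x y z, hom y z -> hom x y -> hom x z
}.
Arguments idm {c} x.
Arguments compm {c x y z} _ _.

Record is_category (C : cat_data) : Prop := IsCategory {
  comp_idl : forall (x y : ob C) (f : hom x y), compm (idm y) f = f;
  comp_idr : forall (x y : ob C) (f : hom x y), compm f (idm x) = f;
  comp_assoc : forall (w x y z : ob C) (h : hom y z) (g : hom x y) (f : hom w x),
    compm (compm h g) f = compm h (compm g f)
}.

Record functor_data (C D : cat_data) := FunctorData {
  fob : ob C -> ob D;
  fmor : forall x y, hom x y -> hom (fob x) (fob y)
}.
Arguments fmor {C D} f {x y} _.

Record is_functor (C D : cat_data) (F : functor_data C D) : Prop := IsFunctor {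
  fmor_id : forall x, fmor F (idm x) = idm (fob F x);
  fmor_comp : forall (x y z : ob C) (g : hom y z) (f : hom x y),
    fmor F (compm g f) = compm (fmor F g) (fmor F f)
}.

Definition fun_id (C : cat_data) : functor_data C C :=
  @FunctorData C C (fun x => x) (fun x y f => f).

Definition fun_comp (C D E : cat_data) (G : functor_data D E)
    (F : functor_data C D) : functor_data C E :=
  @FunctorData C E (fun x => fob G (fob F x)) (fun x y f => fmor G (fmor F f)).

Definition cat_one : cat_data :=
  @CatData unit (fun _ _ => unit) (fun _ => tt) (fun _ _ _ _ _ => tt).

Definition cat_prod (C D : cat_data) : cat_data :=
  @CatData (ob C * ob D)
    (fun x y => (hom x.1 y.1 * hom x.2 y.2)%type)
    (fun x => (idm x.1, idm x.2))
    (fun x y z g f => (compm g.1 f.1, compm g.2 f.2)).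

Definition fun_prod (C C' D D' : cat_data) (F : functor_data C D)
    (G : functor_data C' D') : functor_data (cat_prod C C') (cat_prod D D') :=
  @FunctorData (cat_prod C C') (cat_prod D D')
    (fun x => (fob F x.1, fob G x.2))
    (fun x y f => (fmor F f.1, fmor G f.2)).

Definition associator (C D E : cat_data) :
    functor_data (cat_prod (cat_prod C D) E) (cat_prod C (cat_prod D E)) :=
  @FunctorData (cat_prod (cat_prod C D) E) (cat_prod C (cat_prod D E))
    (fun x => (x.1.1, (x.1.2, x.2)))
    (fun x y f => (f.1.1, (f.1.2, f.2))).

Definition left_unitor (C : cat_data) : functor_data (cat_prod cat_one C) C :=
  @FunctorData (cat_prod cat_one C) C (fun x => x.2) (fun x y f => f.2).

Definition right_unitor (C : cat_data) : functor_data (cat_prod C cat_one) C :=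
  @FunctorData (cat_prod C cat_one) C (fun x => x.1) (fun x y f => f.1).

Record two_cat_data := TwoCatData {
  obj : Type;
  homcat : obj -> obj -> cat_data;
  hcomp : forall A B C,
    functor_data (cat_prod (homcat B C) (homcat A B)) (homcat A C);
  hunit : forall A, functor_data cat_one (homcat A A)
}.
Arguments hcomp {t} A B C.
Arguments hunit {t} A.

(** A category enriched over small categories. The last three axioms are
    equalities of functors: they cover both 1-morphisms and 2-morphisms. *)
Record is_two_category (K : two_cat_data) : Prop := IsTwoCategory {
  homcat_category : forall A B : obj K, is_category (homcat A B);
  hcomp_functor : forall A B C : obj K, is_functor (hcomp A B C);
  hunit_functor : forall A : obj K, is_functor (hunit A);
  hcomp_assoc : forall A B C D : obj K,
    fun_comp (hcomp A B D) (fun_prod (hcomp B C D) (fun_id (homcat A B))) =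
    fun_comp (fun_comp (hcomp A C D) (fun_prod (fun_id (homcat C D)) (hcomp A B C)))
             (associator (homcat C D) (homcat B C) (homcat A B));
  hcomp_unitl : forall A B : obj K,
    fun_comp (hcomp A B B) (fun_prod (hunit B) (fun_id (homcat A B))) =
    left_unitor (homcat A B);
  hcomp_unitr : forall A B : obj K,
    fun_comp (hcomp A A B) (fun_prod (fun_id (homcat A B)) (hunit A)) =
    right_unitor (homcat A B)
}.

Section BData.
Variable n : nat.
Implicit Types (p s t r : 'S_n) (alpha beta : parmon n).

(** The product of ['S_n] in the library is in diagrammatic order. *)
Definition compS (t p : 'S_n) : 'S_n := (p * t)%g.

Lemma compSE t p x : compS t p x = t (p x).
Proof. exact: permM. Qed.

Definition BHom (p s : 'S_n) : {set parmon n} :=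
  [set alpha in PP n | refines (graph p) alpha & refines (graph s) alpha].

Definition vcomp_closed : Prop :=
  forall p s t alpha beta, alpha \in BHom p s -> beta \in BHom s t ->
    joinp beta alpha \in BHom p t.

Definition vid_closed : Prop := forall p, graph p \in BHom p p.

Definition hcomp_closed : Prop :=
  forall p s t r alpha beta, alpha \in BHom p s -> beta \in BHom t r ->
    pmul beta alpha \in BHom (compS t p) (compS r s).

(** These are families of boolean facts, so the data below do not depend on the
    choice of their proofs. *)
Hypotheses (vC : vcomp_closed) (vI : vid_closed) (hC : hcomp_closed).

Definition Bcat : cat_data :=
  @CatData 'S_n
    (fun p s => {alpha : parmon n | alpha \in BHom p s})
    (fun p => exist _ (graph p) (vI p))
    (fun p s t b a =>
       exist _ (joinp (sval b) (sval a)) (vC (svalP a) (svalP b))).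

Definition Bhcomp : functor_data (cat_prod Bcat Bcat) Bcat :=
  @FunctorData (cat_prod Bcat Bcat) Bcat
    (fun x => compS x.1 x.2)
    (fun x y f =>
       exist _ (pmul (sval f.1) (sval f.2)) (hC (svalP f.2) (svalP f.1))).

Definition Bhunit : functor_data cat_one Bcat :=
  @FunctorData cat_one Bcat (fun _ => 1%g : 'S_n) (fun _ _ _ => @idm Bcat (1%g : 'S_n)).

Definition Bdata : two_cat_data :=
  @TwoCatData unit (fun _ _ => Bcat) (fun _ _ _ => Bhcomp) (fun _ => Bhunit).

End BData.

(* Main.v *)
Require Import Defs.
From mathcomp Require Import all_boot all_fingroup.
From Stdlib Require Import FunctionalExtensionality.

Set Implicit Arguments.
Unset Strict Implicit.
Unset Printing Implicit Defensive.

(** A partition [a] of the doubled set that contains the graph of a permutation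
    [s] is determined by [s] and by its trace [top a] on the unprimed points,
    because every primed point lies in the part of an unprimed one. The trace can
    be an arbitrary partition of [n], and such an [a] automatically has only
    propagating parts. So the 2-morphisms amount to set partitions of [n] on
    which permutations act by [restrict], and in these terms (for [a] above [s]
    and [b] above [t])

      top (joinp a b) = joinp (top a) (top b)                  (if t = s)
      top (pmul b a)  = joinp (top a) (restrict s (top b)).

    These are [top_join] and [top_pmul]: the product of [P_n] becomes that of a
    semidirect product of the join semilattice of set partitions with [S_n]. The
    second formula does not depend on which permutation below [a] is taken for
    [s]; this is what the interchange law needs, since there the two inner
    factors share the middle permutation of a vertical composite.

    By [top_inj] an equation between 2-morphisms may be checked on traces. As
    permutations preserve joins ([restrict_perm_join]), interchange becomes
    [joinpACA], associativity becomes [joinpA], and the unit laws hold because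
    the trace of a permutation is the discrete partition, which is the least
    one. *)

(** * Set partitions as equivalence relations *)

Section Linked.
Variable T : finType.
Implicit Types (F : {set {set T}}) (rho tau upsilon : setpart T).

Lemma linked_pblock rho x y : linked rho x y = (y \in pblock rho x).
Proof.
have /and3P[/eqP covT tI _] := partsP rho.
apply/'exists_andP/idP => [[B [rB /andP[Bx By]]]|xy].
  by rewrite (def_pblock tI rB Bx).
have xC : x \in cover rho by rewrite covT inE.
by exists (pblock rho x); rewrite pblock_mem // mem_pblock xC.
Qed.

Lemma linked_refl rho : reflexive (linked rho).
Proof.
move=> x; rewrite linked_pblock mem_pblock.
by have /and3P[/eqP-> _ _] := partsP rho; rewrite inE.
Qed.

Lemma linked_sym rho : symmetric (linked rho).
Proof. by move=> x y; apply: eq_existsb => B; rewrite (andbC (x \in B)). Qed.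

Lemma linked_trans rho : transitive (linked rho).
Proof.
have /and3P[_ tI _] := partsP rho.
move=> y x z; rewrite !linked_pblock => xy.
by rewrite (same_pblock tI xy).
Qed.

Lemma eq_linked rho tau : linked rho =2 linked tau -> rho = tau.
Proof.
move=> eq_rt; apply: val_inj => /=.
rewrite -(equivalence_partition_pblock (partsP rho)).
rewrite -(equivalence_partition_pblock (partsP tau)).
apply: eq_imset => x; apply/setP=> y.
by rewrite !inE /= -!linked_pblock eq_rt.
Qed.

Lemma linked_finest F : linked (finest F) =2 connect (linked F).
Proof.
move=> x y; rewrite linked_pblock.
by rewrite (pblock_equivalence_partition (@linked_equiv T F)) ?inE.
Qed.

Lemma refinesP rho tau :
  reflect (subrel (linked rho) (linked tau)) (refines rho tau).
Proof.
have /and3P[_ _ r0] := partsP rho.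
apply: (iffP forall_inP) => [le x y /'exists_andP[B [rB /andP[Bx By]]] | sub B rB].
  have /'exists_andP[C [tC /subsetP BC]] := le B rB.
  by apply/'exists_andP; exists C; rewrite tC !BC.
have /set0Pn[x Bx] : B != set0 by apply: contraNneq r0 => <-.
have /and3P[/eqP covT _ _] := partsP tau.
apply/'exists_andP; exists (pblock tau x); rewrite pblock_mem ?covT ?inE //.
split=> //; apply/subsetP=> y By; rewrite -linked_pblock; apply: sub.
by apply/'exists_andP; exists B; rewrite rB Bx.
Qed.

Lemma refines_refl rho : refines rho rho.
Proof. exact/refinesP. Qed.

Lemma refines_trans rho tau upsilon :
  refines rho tau -> refines tau upsilon -> refines rho upsilon.
Proof. by move=> /refinesP rt /refinesP tu; apply/refinesP => x y /rt/tu. Qed.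

Lemma refines_anti rho tau : refines rho tau -> refines tau rho -> rho = tau.
Proof.
move=> /refinesP rt /refinesP tr; apply: eq_linked => x y.
by apply/idP/idP => [/rt|/tr].
Qed.

(** Yoneda for the refinement order: this turns the universal property of the
    join into equations between joins. *)
Lemma refines_ub_eq rho tau : refines rho =1 refines tau -> rho = tau.
Proof.
move=> eq_ub.
by apply: refines_anti; rewrite ?eq_ub ?refines_refl // -eq_ub refines_refl.
Qed.

Lemma joinp_ge rho tau :
  refines rho (joinp rho tau) /\ refines tau (joinp rho tau).
Proof. by apply/andP; rewrite -join_lub refines_refl. Qed.

Lemma joinpA : associative (@joinp T).
Proof.
by move=> rho tau sigma; apply: refines_ub_eq => upsilon; rewrite !join_lub andbA.
Qed.

Lemma joinpC : commutative (@joinp T).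
Proof. by move=> rho tau; apply: refines_ub_eq => upsilon; rewrite !join_lub andbC. Qed.

Lemma joinpACA : interchange (@joinp T) (@joinp T).
Proof.
move=> rho tau sigma chi.
by rewrite -!joinpA; congr (joinp _ _); rewrite !joinpA (joinpC tau).
Qed.

Lemma joinp_absorbl rho tau : refines rho tau -> joinp rho tau = tau.
Proof.
move=> le; apply: refines_ub_eq => upsilon; rewrite join_lub.
by apply: andb_idl; apply: refines_trans le.
Qed.

End Linked.

(** * Restriction along a map *)

Lemma linked_restrict (S T : finType) (f : S -> T) (tau : setpart T) x y :
  linked (restrict f tau) x y = linked tau (f x) (f y).
Proof.
apply/'exists_andP/'exists_andP => [[B []]|[B [tB /andP[Bx By]]]].
  move=> /setD1P[_ /imsetP[C tC ->]]; rewrite !inE => xy.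
  by exists C.
exists (f @^-1: B); rewrite !inE Bx By; split=> //; apply/andP; split.
  by apply/set0Pn; exists x; rewrite inE.
exact: imset_f.
Qed.

Lemma refines_restrict (S T : finType) (f : S -> T) (rho tau : setpart T) :
  refines rho tau -> refines (restrict f rho) (restrict f tau).
Proof.
by move=> /refinesP le; apply/refinesP => x y; rewrite !linked_restrict => /le.
Qed.

(** Restriction along [f] is right adjoint to taking images under [f]; this is
    how an upper bound of the family glued in a product is recognised. *)
Lemma refines_imset (S T : finType) (f : S -> T) (rho : setpart S) (tau : setpart T) :
  refines rho (restrict f tau) ->
  refines [set f @: (B : {set S}) | B in (rho : {set {set S}})] tau.
Proof.
move=> /forall_inP le; apply/forall_inP => _ /imsetP[B rB ->].
have /'exists_andP[_ [/setD1P[_ /imsetP[C tC ->]] BC]] := le B rB.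
by apply/'exists_andP; exists C; rewrite tC sub_imset_pre.
Qed.

Lemma restrict_comp (R S T : finType) (f : R -> S) (g : S -> T) (tau : setpart T) :
  restrict f (restrict g tau) = restrict (g \o f) tau.
Proof. by apply: eq_linked => x y; rewrite !linked_restrict. Qed.

Lemma restrict_id (T : finType) (f : T -> T) (tau : setpart T) :
  f =1 id -> restrict f tau = tau.
Proof. by move=> fid; apply: eq_linked => x y; rewrite linked_restrict !fid. Qed.

(** Restriction along a map does not preserve joins, since a chain of links may
    leave the image; a permutation has no such outside. *)
Lemma restrict_perm_join (T : finType) (s : {perm T}) (rho tau : setpart T) :
  restrict s (joinp rho tau) = joinp (restrict s rho) (restrict s tau).
Proof.
have rK : cancel (@restrict T T s) (restrict s^-1%g).
  by move=> sigma; rewrite restrict_comp restrict_id // => x; apply: permKV.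
have rVK : cancel (restrict s^-1%g) (@restrict T T s).
  by move=> sigma; rewrite restrict_comp restrict_id // => x; apply: permK.
have adj sigma upsilon :
    refines (restrict s sigma) upsilon = refines sigma (restrict s^-1%g upsilon).
  apply/idP/idP => le; first by rewrite -(rK sigma) refines_restrict.
  by rewrite -(rVK upsilon) refines_restrict.
by apply: refines_ub_eq => upsilon; rewrite adj !join_lub !adj.
Qed.

(** * Partitions above a permutation *)

Section AbovePermutation.
Variable n : nat.
Implicit Types (p q r s t : 'S_n) (a b : parmon n) (u v : dbl n).

Definition top a : setpart 'I_n := restrict inl a.

Lemma linked_top a x y : linked (top a) x y = linked a (inl x) (inl y).
Proof. exact: linked_restrict. Qed.

Lemma refines_graphP s a :
  reflect (forall x, linked a (inl x) (inr (s x))) (refines (graph s) a).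
Proof.
apply: (iffP (refinesP _ _)) => [le x | sx u v].
  apply: le; apply/'exists_andP; exists [set inl x; inr (s x)].
  by split; [apply: imset_f | rewrite !in_set2 !eqxx orbT].
case/'exists_andP => _ [/imsetP[x _ ->]]; rewrite !in_set2.
by case/andP=> /orP[]/eqP-> /orP[]/eqP->; rewrite ?linked_refl // linked_sym.
Qed.

(** The block of [x] contains [s x] primed, so no block can stay in one row. *)
Lemma above_PP s a : refines (graph s) a -> a \in PP n.
Proof.
move=> /refines_graphP sa; rewrite inE; apply/forall_inP => B aB.
have /and3P[_ tI a0] := partsP a.
have inB u v : u \in B -> linked a u v -> v \in B.
  by move=> Bu; rewrite linked_pblock (def_pblock tI aB Bu).
have /set0Pn[[x|y] Bu] : B != set0 by apply: contraNneq a0 => <-.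
  by apply/andP; split; apply/existsP; [exists x | exists (s x); apply: inB (sa x)].
apply/andP; split; apply/existsP; last by exists y.
exists (s^-1%g y); apply: inB Bu _.
by rewrite linked_sym -{2}[y](permKV s) sa.
Qed.

Lemma mem_BHom p s a :
  (a \in BHom p s) = refines (graph p) a && refines (graph s) a.
Proof. by rewrite inE andb_idl // => /andP[/above_PP]. Qed.

(** Folds the primed row back onto the unprimed one along [s]. *)
Definition retract s u : 'I_n :=
  match u with inl x => x | inr y => s^-1%g y end.

Lemma linked_retract s a u : refines (graph s) a -> linked a (inl (retract s u)) u.
Proof.
move=> /refines_graphP sa; case: u => [x|y] /=; first exact: linked_refl.
by rewrite -{2}[y](permKV s).
Qed.

(** Each primed point lies in the part of an unprimed one, hence the trace on the
    unprimed points determines the partition. *)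
Lemma restrict_retract_top s a :
  refines (graph s) a -> restrict (retract s) (top a) = a.
Proof.
move=> sa; apply: eq_linked => u v; rewrite linked_restrict linked_top.
have lu w := linked_retract w sa.
apply/idP/idP => uv.
  rewrite linked_sym in uv; apply: linked_trans (lu v).
  by rewrite linked_sym; apply: linked_trans (lu u).
by apply: linked_trans (lu u) _; apply: linked_trans uv _; rewrite linked_sym.
Qed.

Lemma top_restrict_retract s (tau : setpart 'I_n) :
  top (restrict (retract s) tau) = tau.
Proof. by rewrite /top restrict_comp restrict_id. Qed.

Lemma top_inj s a b :
  refines (graph s) a -> refines (graph s) b -> top a = top b -> a = b.
Proof. by move=> sa sb ab; rewrite -(restrict_retract_top sa) ab restrict_retract_top. Qed.

(** The upper bound comes from pulling the join of the traces back along the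
    folding map, which gives a partition above both [a] and [b]. *)
Lemma top_join s a b :
  refines (graph s) a -> refines (graph s) b ->
  top (joinp a b) = joinp (top a) (top b).
Proof.
move=> sa sb; have [aj bj] := joinp_ge a b.
have [taj tbj] := joinp_ge (top a) (top b).
apply: refines_anti; last by rewrite join_lub !refines_restrict.
rewrite -[joinp (top a) _](top_restrict_retract s); apply: refines_restrict.
rewrite join_lub -{1}(restrict_retract_top sa) -{2}(restrict_retract_top sb).
by rewrite !refines_restrict.
Qed.

Lemma linked_top_graph s x y : linked (top (graph s)) x y = (x == y).
Proof.
rewrite linked_top; apply/idP/eqP => [|->]; last exact: linked_refl.
case/'exists_andP => _ [/imsetP[z _ ->]]; rewrite !in_set2 !orbF.
by case/andP => /eqP[->] /eqP[->].
Qed.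

Lemma top_graph_min s (tau : setpart 'I_n) : refines (top (graph s)) tau.
Proof.
by apply/refinesP => x y; rewrite linked_top_graph => /eqP->; apply: linked_refl.
Qed.

(** * The product *)

(** The family whose finest common coarsening [pmul] restricts to the outer
    rows. *)
Definition glued b a : {set {set tpl n}} :=
  [set @upper n @: (B : {set dbl n}) | B in (b : {set {set dbl n}})] :|:
  [set @lower n @: (B : {set dbl n}) | B in (a : {set {set dbl n}})].

Lemma linked_pmul b a u v :
  linked (pmul b a) u v = connect (linked (glued b a)) (outer u) (outer v).
Proof. by rewrite linked_restrict linked_finest. Qed.

Lemma glued_upper b a u v :
  linked b u v -> connect (linked (glued b a)) (upper u) (upper v).
Proof.
case/'exists_andP=> B [bB /andP[Bu Bv]]; apply/connect1/'exists_andP.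
by exists (@upper n @: B); rewrite inE !imset_f.
Qed.

Lemma glued_lower b a u v :
  linked a u v -> connect (linked (glued b a)) (lower u) (lower v).
Proof.
case/'exists_andP=> B [aB /andP[Bu Bv]]; apply/connect1/'exists_andP.
by exists (@lower n @: B); rewrite inE !imset_f ?orbT.
Qed.

Lemma pmul_above t s b a :
  refines (graph t) b -> refines (graph s) a ->
  refines (graph (compS t s)) (pmul b a).
Proof.
move=> /refines_graphP tb /refines_graphP sa; apply/refines_graphP => x.
rewrite linked_pmul compSE.
apply: (connect_trans (y := inl (inr (s x)))).
  exact: (glued_lower b (sa x)).
exact: (glued_upper a (tb (s x))).
Qed.

(** Folds all three rows of the glued diagram onto the first. *)
Definition retract3 t s (w : tpl n) : 'I_n :=
  match w with inl u => retract s u | inr z => s^-1%g (t^-1%g z) end.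

(** A link of [b] between middle points is carried to the first row by the links
    of [a] between [x] and [s x], so both partitions on the right lie below the
    trace of the product. Conversely, a chain of links through the glued diagram
    folds down to a chain of links of [a] and [b] within the first row. *)
Lemma top_pmul t s b a :
  refines (graph t) b -> refines (graph s) a ->
  top (pmul b a) = joinp (top a) (restrict s (top b)).
Proof.
move=> tb sa; apply: refines_anti; last first.
  rewrite join_lub; apply/andP; split; apply/refinesP => x y.
    rewrite !linked_top linked_pmul => xy; exact: (glued_lower b xy).
  rewrite linked_restrict !linked_top linked_pmul => xy.
  have {}sa := elimT (refines_graphP s a) sa.
  have sy := sa y; rewrite linked_sym in sy.
  apply: (connect_trans (glued_lower b (sa x))).
  exact: (connect_trans (glued_upper a xy) (glued_lower b sy)).
(* Pulled back along the folding map, the join bounds the glued family, hence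
   also the chains of links that define the product. *)
set J := joinp _ _.
have [aJ bJ] : refines (top a) J /\ refines (restrict s (top b)) J by apply: joinp_ge.
have gJ : refines (glued b a) (restrict (retract3 t s) J).
  apply/forall_inP => X /setUP[]; apply/forall_inP: X; apply: refines_imset.
    rewrite restrict_comp -(restrict_retract_top tb).
    apply/refinesP => u v; rewrite !linked_restrict => uv.
    have up w : (retract3 t s \o @upper n) w = (s^-1)%g (retract t w) by case: w.
    rewrite !up; apply: (refinesP _ _ bJ).
    by rewrite linked_restrict !permKV linked_restrict.
  rewrite restrict_comp -(restrict_retract_top sa).
  apply/refinesP => u v; rewrite !linked_restrict => uv.
  by apply: (refinesP _ _ aJ); rewrite linked_restrict.
apply/refinesP => x y; rewrite linked_top linked_pmul -linked_finest.
by move/(refinesP _ _ (finest_le gJ)); rewrite linked_restrict.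
Qed.

Lemma pmul_graph t s : pmul (graph t) (graph s) = graph (compS t s).
Proof.
have gr p := refines_refl (graph p).
apply: (@top_inj (compS t s)) => //; first exact: pmul_above.
rewrite (@top_pmul t s) // joinp_absorbl ?top_graph_min //.
by apply: eq_linked => x y; rewrite linked_restrict !linked_top_graph (inj_eq perm_inj).
Qed.

(** The permutations [s] and [r] in the middle of the vertical composites lie below
    all four factors, so every product here is computed by the same instance of
    [top_pmul]. *)
Lemma pmul_interchange p s t r q w a a' b b' :
  a \in BHom p s -> a' \in BHom s q -> b \in BHom t r -> b' \in BHom r w ->
  pmul (joinp b' b) (joinp a' a) = joinp (pmul b' a') (pmul b a).
Proof.
rewrite !mem_BHom => /andP[_ sa] /andP[sa' _] /andP[_ rb] /andP[rb' _].
have join_above z c d : refines (graph z) c -> refines (graph z) (joinp c d).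
  by move=> zc; apply: refines_trans zc (proj1 (joinp_ge _ _)).
apply: (@top_inj (compS r s)).
- by apply: pmul_above; apply: join_above.
- exact/join_above/pmul_above.
rewrite (@top_join (compS r s)) ?pmul_above //.
rewrite !(@top_pmul r s) ?join_above // (top_join rb' rb) (top_join sa' sa).
by rewrite restrict_perm_join joinpACA.
Qed.

Lemma pmulA t s p c b a :
  refines (graph t) c -> refines (graph s) b -> refines (graph p) a ->
  pmul (pmul c b) a = pmul c (pmul b a).
Proof.
move=> tc sb pa.
apply: (@top_inj (compS (compS t s) p)); first by rewrite !pmul_above.
  by rewrite /compS mulgA !pmul_above.
rewrite (@top_pmul (compS t s) p) ?pmul_above // (@top_pmul t s) //.
rewrite (@top_pmul t (compS s p)) ?pmul_above // (@top_pmul s p) //.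
rewrite restrict_perm_join joinpA restrict_comp; congr (joinp _ _).
by apply: eq_linked => x y; rewrite !linked_restrict /= compSE compSE.
Qed.

Lemma pmul1l s a : refines (graph s) a -> pmul (graph 1%g) a = a.
Proof.
move=> sa; apply: (@top_inj s) => //.
  by rewrite -[s in graph s]mulg1 pmul_above ?refines_refl.
rewrite (@top_pmul 1%g s) ?refines_refl // joinpC joinp_absorbl //.
apply/refinesP => x y; rewrite linked_restrict linked_top_graph (inj_eq perm_inj).
by move/eqP->; apply: linked_refl.
Qed.

Lemma pmul1r s a : refines (graph s) a -> pmul a (graph 1%g) = a.
Proof.
move=> sa; apply: (@top_inj s) => //.
  by rewrite -[s in graph s]mul1g pmul_above ?refines_refl.
rewrite (@top_pmul s 1%g) ?refines_refl // joinp_absorbl ?top_graph_min //.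
by apply: restrict_id => x; rewrite perm1.
Qed.

End AbovePermutation.

(** * The two-category *)

Section TwoCategory.
Variable n : nat.

Lemma BHom_vcomp : vcomp_closed n.
Proof.
move=> p s t a b; rewrite !mem_BHom => /andP[pa _] /andP[_ tb].
have [bj aj] := joinp_ge b a.
by rewrite (refines_trans pa aj) (refines_trans tb bj).
Qed.

Lemma BHom_vid : vid_closed n.
Proof. by move=> p; rewrite mem_BHom refines_refl. Qed.

Lemma BHom_hcomp : hcomp_closed n.
Proof.
move=> p s t r a b; rewrite !mem_BHom => /andP[pa sa] /andP[tb rb].
by rewrite !pmul_above.
Qed.

Let B := Bdata BHom_vcomp BHom_vid BHom_hcomp.

(** Hom-types over equal but not convertible permutations are different types;
    comparing the underlying partitions avoids any transport. *)
Lemma eq_functor_Bcat (C : cat_data)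
    (F G : functor_data C (Bcat BHom_vcomp BHom_vid)) :
  (forall x, fob F x = fob G x) ->
  (forall x y (f : hom x y), sval (fmor F f) = sval (fmor G f)) ->
  F = G.
Proof.
case: F G => [F0 F1] [G0 G1] /= /functional_extensionality eq0.
case: G0 / eq0 G1 => G1 eq1; congr FunctorData.
apply: functional_extensionality_dep => x.
apply: functional_extensionality_dep => y.
by apply: functional_extensionality => f; apply: val_inj; apply: eq1.
Qed.

Lemma Bhom_above (p s : 'S_n) (f : {a : parmon n | a \in BHom p s}) :
  refines (graph p) (sval f) /\ refines (graph s) (sval f).
Proof. by apply/andP; rewrite -mem_BHom; apply: (svalP f). Qed.

Lemma Bdata_two_category : is_two_category B.
Proof.
split.
- move=> ? ?; split=> [p s f|p s f|p q s t h g f]; apply: val_inj => /=.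
  + by have [_ sf] := Bhom_above f; apply: joinp_absorbl.
  + by have [pf _] := Bhom_above f; rewrite joinpC; apply: joinp_absorbl.
  + by rewrite joinpA.
- move=> ? ? ?; split=> [[t s]|[r q] [t s] [w p] [b' a'] [b a]]; apply: val_inj => /=.
    exact: pmul_graph.
  exact: pmul_interchange (svalP a) (svalP a') (svalP b) (svalP b').
- move=> ?; split=> // -[] [] [] [] []; apply: val_inj => /=.
  by rewrite joinp_absorbl ?refines_refl.
- move=> ? ? ? ?; apply: eq_functor_Bcat => [[[t s] p]|x y [[h g] f]] /=.
    by rewrite /compS mulgA.
  have [hx _] := Bhom_above h; have [gx _] := Bhom_above g.
  by have [fx _] := Bhom_above f; apply: pmulA hx gx fx.
- move=> ? ?; apply: eq_functor_Bcat => [[? s]|x y [? f]] /=.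
    by rewrite /compS mulg1.
  by have [fx _] := Bhom_above f; apply: pmul1l fx.
- move=> ? ?; apply: eq_functor_Bcat => [[s ?]|x y [f ?]] /=.
    by rewrite /compS mul1g.
  by have [fx _] := Bhom_above f; apply: pmul1r fx.
Qed.

End TwoCategory.

Theorem proposition4 (n : nat) (hn : 0 < n) :
  exists (vC : vcomp_closed n) (vI : vid_closed n) (hC : hcomp_closed n),
    is_two_category (Bdata vC vI hC).
Proof.
exists (@BHom_vcomp n), (@BHom_vid n), (@BHom_hcomp n).
exact: Bdata_two_category.
Qed.
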